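(* Let $1/q$ be a prime power, $\Bbbk=\mathbb{F}_{1/q}$, $\alpha=(\alpha_1,\dots,\alpha_k)$, $\beta=(\beta_1,\dots,\beta_l)$ weak compositions of $n$, and $M\in\mathbb{N}^{k\times l}$ with row sums $\alpha$ and column sums $\beta$. Then $$\sum_{[V]}\frac{1}{|\mathrm{Aut}(V)|}=\frac{q^{n+n(\alpha)+n(\beta)}(1-q)^{-n}}{\prod_{i,j}[M_{i,j}]_q!},$$ where the sum runs over isomorphism classes of finite-dimensional $\Pi(Q(k,l))$-modules $V$ whose restriction to a $\Bbbk Q(k,l)$-module is isomorphic to $V_M$.
   Context: $n(\alpha)=\sum\binom{\alpha_i}2$, $[m]_q!=\prod_{r\le m}(1+\cdots+q^{r-1})$. $Q(k,l)$ is the quiver with vertices $k-1,k-2,\dots,1,0,-1,\dots,-l+1$ and arrows $i\to i-1$ for $1\le i\le k-1$ and $i\to i+1$ for $-l+1\le i\le-1$ (all pointing toward $0$). The double quiver adds a reverse arrow $\bar a$ for each arrow $a$. A $\Pi(Q(k,l))$-module (preprojective algebra module) is a representation $V$ of the double quiver (finite-dimensional spaces $V(i)$ and linear maps $V(a)$, $V(\bar a)$) satisfying, at every vertex $i$, $\sum_{a:\,s(a)=i}V(\bar a)V(a)=\sum_{a:\,t(a)=i}V(a)V(\bar a)$, where $s,t$ are source and target. Restriction to $\Bbbk Q(k,l)$ forgets the maps $V(\bar a)$. For $1\le i\le k$, $1\le j\le l$, $V_{i,j}$ is the representation of $Q(k,l)$ with $V_{i,j}(v)=\Bbbk$ for $k-i\ge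 v\ge -l+j$ and $0$ otherwise, each arrow between two vertices in this range acting by the identity and others by $0$; $V_M=\bigoplus_{i,j}V_{i,j}^{\oplus M_{i,j}}$. $\mathrm{Aut}(V)$ is the group of module automorphisms. *)

(* Defs.v *)
From HB Require Import structures.
From mathcomp Require Import all_boot all_order all_algebra.
Set Implicit Arguments. Unset Strict Implicit. Unset Printing Implicit Defensive.
Import Order.TTheory GRing.Theory Num.Theory.
Local Open Scope ring_scope.

Definition nfun (m : nat) (a : 'I_m -> nat) : nat := (\sum_(i < m) 'C(a i, 2))%N.

Definition qfact (q : rat) (m : nat) : rat :=
  \prod_(1 <= r < m.+1) \sum_(s < r) q ^+ s.

Section Preproj.
Variables (F : finFieldType) (k l : nat) (M : 'M[nat]_(k, l)).

(* Vertices of Q(k,l): vertex v in {-l+1,...,k-1} is encoded by t = v + l - 1,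
   t = 0 .. nE.  Edge e (e < nE) joins t = e and t = e+1. *)
Definition nE : nat := (k + l).-2.

Definition lftv (e : 'I_nE) : 'I_nE.+1 := widen_ord (leqnSn nE) e.
Definition rgtv (e : 'I_nE) : 'I_nE.+1 := @Ordinal nE.+1 e.+1 (ltn_ord e).

(* the arrow of Q(k,l) on edge e points from vertex e to vertex e+1 iff
   (in paper labels) its target is <= 0, i.e. e < l-1; otherwise from e+1 to e *)
Definition fwd (e : nat) : bool := (e < l.-1)%N.

(* Basis of V_M at vertex t: triples (i,j,c) (0-based i,j), c < M_{ij},
   with V_{i+1,j+1} supported at t, i.e. j <= t <= nE - i
   (paper: -l+(j+1) <= v <= k-(i+1)). *)
Definition Mbound : nat := (\sum_(i < k) \sum_(j < l) M i j)%N.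
Definition Bset (t : nat) : {set 'I_k * 'I_l * 'I_Mbound} :=
  [set b : 'I_k * 'I_l * 'I_Mbound | ((b.2 < M b.1.1 b.1.2) && (b.1.2 <= t <= nE - b.1.1))%N].
Definition pdim (t : nat) : nat := #|Bset t|.

(* Pi(Q(k,l))-module structures (double-quiver representations) on the
   spaces V(t) = F^(pdim t): for each edge e a map V(e) -> V(e+1) (R) and a
   map V(e+1) -> V(e) (L).  Maps act on row vectors. *)
Definition Rep := ({dffun forall e : 'I_nE, 'M[F]_(pdim e, pdim e.+1)} *
                   {dffun forall e : 'I_nE, 'M[F]_(pdim e.+1, pdim e)})%type.

Definition VertMaps := {dffun forall t : 'I_nE.+1, 'M[F]_(pdim t)}.

Definition is_hom (g : VertMaps) (V W : Rep) : bool :=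
  [forall e : 'I_nE, (V.1 e *m g (rgtv e) == g (lftv e) *m W.1 e) &&
                     (V.2 e *m g (lftv e) == g (rgtv e) *m W.2 e)].
Definition is_iso (g : VertMaps) (V W : Rep) : bool :=
  [forall t, g t \in unitmx] && is_hom g V W.
Definition iso_rep (V W : Rep) : bool := [exists g, is_iso g V W].
Definition Aut (V : Rep) : {set VertMaps} := [set g | is_iso g V V].

(* preprojective relation: at vertex t, the contribution of the edge to the
   right of t (edge t) and of the edge to the left (edge t-1); each composite
   through an arrow a counted with + if t = s(a) (V(abar)V(a)) and - if
   t = t(a) (V(a)V(abar)). *)
Definition termL (V : Rep) (e : 'I_nE) : 'M[F]_(pdim e) :=
  if fwd e then V.1 e *m V.2 e else - (V.1 e *m V.2 e).
Definition termR (V : Rep) (e : 'I_nE) : 'M[F]_(pdim e.+1) :=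
  if fwd e then - (V.2 e *m V.1 e) else V.2 e *m V.1 e.
Definition termL_at (V : Rep) (t : nat) : 'M[F]_(pdim t) :=
  (if (t < nE)%N as b return ((t < nE)%N = b -> 'M[F]_(pdim t))
   then fun H => termL V (Ordinal H) else fun _ => 0) (erefl (t < nE)%N).
Definition termR_at (V : Rep) (t : nat) : 'M[F]_(pdim t) :=
  match t return 'M[F]_(pdim t) with
  | 0 => 0
  | s.+1 => (if (s < nE)%N as b return ((s < nE)%N = b -> 'M[F]_(pdim s.+1))
             then fun H => termR V (Ordinal H) else fun _ => 0) (erefl (s < nE)%N)
  end.
Definition preproj (V : Rep) : bool :=
  [forall t : 'I_nE.+1, termL_at V t + termR_at V t == 0].

Definition VMR (e : nat) : 'M[F]_(pdim e, pdim e.+1) :=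
  \matrix_(x, y) (enum_val x == enum_val y)%:R.
Definition VML (e : nat) : 'M[F]_(pdim e.+1, pdim e) :=
  \matrix_(x, y) (enum_val x == enum_val y)%:R.

Definition resQ_iso_VM (V : Rep) : bool :=
  [exists g : VertMaps, [forall t, g t \in unitmx] &&
    [forall e : 'I_nE, if fwd e then V.1 e *m g (rgtv e) == g (lftv e) *m VMR e
                       else V.2 e *m g (lftv e) == g (rgtv e) *m VML e]].

Definition admissible : {set Rep} := [set V | preproj V && resQ_iso_VM V].
Definition isoclasses : {set {set Rep}} :=
  equivalence_partition iso_rep admissible.

Definition sum_inv_aut : rat :=
  \sum_(C in isoclasses)
     match [pick V in C] with Some V => (#|Aut V|%:R)^-1 | None => 0 end.
End Preproj.

(* Main.v *)
(** Fix the vector spaces of V_M and let G be the product of their general linear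
    groups.  By orbit-stabilizer the weighted number of isomorphism classes is the
    number of admissible modules divided by |G|, and transporting the kQ-part to
    V_M turns this into |Y| / |Aut_kQ(V_M)|, where Y is the set of preprojective
    modules whose kQ-part equals V_M.  Under the trace form the linear map
    defining Y is dual to the commutator map with kernel End_kQ(V_M), whence
    |Y| = |End_kQ(V_M)| |k|^(- <V_M, V_M>) with <,> the Euler form.  An endomorphism
    of V_M is block triangular with respect to the summands V_(i,j)^(M_ij), with
    arbitrary diagonal blocks, and is invertible iff they are; so
    |Aut| / |End| = prod |GL_(M_ij)(k)| / |k|^(M_ij^2).  Finally
    <V_M, V_M> = n + n(alpha) + n(beta). *)

Require Import Defs.
From HB Require Import structures.
From mathcomp Require Import all_boot all_order all_algebra.
From mathcomp Require Import zify ring.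
Set Implicit Arguments. Unset Strict Implicit. Unset Printing Implicit Defensive.
Import Order.TTheory GRing.Theory Num.Theory.
Local Open Scope ring_scope.

(** * Counting in finite sets and over finite fields *)

Lemma card_fibers (T T' : finType) (A : {set T}) (B : {set T'}) (f : T -> T')
    (n : nat) :
  {in A, forall x, f x \in B} ->
  {in B, forall y, #|[set x in A | f x == y]| = n} -> #|A| = (#|B| * n)%N.
Proof.
move=> fAB cf; rewrite -sum1_card (partition_big f (mem B)) //=.
rewrite -sum_nat_const; apply: eq_bigr => y yB.
by rewrite -(cf y yB) -sum1_card; apply: eq_bigl => x; rewrite inE.
Qed.

Lemma card_bij_in (T T' : finType) (A : {set T}) (B : {set T'})
    (f : T -> T') (g : T' -> T) :
  {in A, forall x, f x \in B} -> {in B, forall y, g y \in A} ->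
  {in A, cancel f g} -> {in B, cancel g f} -> #|A| = #|B|.
Proof.
move=> fAB gBA fK gK; rewrite -(card_in_imset (can_in_inj fK)).
apply: eq_card => y; apply/imsetP/idP => [[x xA ->]|yB]; first exact: fAB.
by exists (g y); rewrite ?gK ?gBA.
Qed.

Lemma card_dep_family (I : finType) (T : I -> finType) (P : forall i, pred (T i)) :
  #|[set f : {dffun forall i, T i} | [forall i, P i (f i)]]| = (\prod_i #|P i|)%N.
Proof.
transitivity #|(family P : simpl_pred {dffun forall i, T i})|.
  2: by rewrite card_family foldrE big_image.
by apply: eq_card => f; rewrite inE; apply/forallP/familyP.
Qed.

(** Translation by [- a] carries the fiber of [f] over [a] onto its zero fiber. Applied below to
    nonzero affine functionals. *)
Lemma card_translates (F : finFieldType) (T : finType) (A : {set T})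
    (f : T -> F) (tr : F -> T -> T) :
  {in A, forall x a, tr a x \in A} -> (forall a, cancel (tr a) (tr (- a))) ->
  {in A, forall x a, f (tr a x) = f x + a} ->
  #|A| = (#|F| * #|[set x in A | f x == 0%R]|)%N.
Proof.
move=> trA trK ftr; rewrite -cardsT; apply: (card_fibers (f := f)) => // a _.
apply: (card_bij_in (f := tr (- a)) (g := tr a)) => x.
- by rewrite !inE => /andP[xA /eqP fx]; rewrite trA // ftr // fx subrr eqxx.
- by rewrite !inE => /andP[xA /eqP fx]; rewrite trA // ftr // fx add0r eqxx.
- by move=> _; rewrite -{1}[a]opprK trK.
- by move=> _; rewrite trK.
Qed.

(* Both one-sided radicals are compared with the number of zeros of the pairing. *)
Lemma card_radicals (F : finFieldType) (U W : finType) (A : {set U}) (B : {set W})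
    (b : U -> W -> F) :
  let KA := [set u in A | [forall w in B, b u w == 0%R]] in
  let KB := [set w in B | [forall u in A, b u w == 0%R]] in
  {in A, forall u, u \notin KA -> #|B| = (#|F| * #|[set w in B | b u w == 0%R]|)%N} ->
  {in B, forall w, w \notin KB -> #|A| = (#|F| * #|[set u in A | b u w == 0%R]|)%N} ->
  (#|KA| * #|B| = #|KB| * #|A|)%N.
Proof.
(* A radical element vanishes on all of [D], any other on a fraction 1/|F| of it. Multiplying by |F|
   keeps the count in the naturals. *)
have count (S S' : finType) (C : {set S}) (D : {set S'}) (c : S -> S' -> F) :
    let K := [set x in C | [forall y in D, c x y == 0%R]] in
    {in C, forall x, x \notin K -> #|D| = (#|F| * #|[set y in D | c x y == 0%R]|)%N} ->
    (#|F| * \sum_(x in C) #|[set y in D | c x y == 0%R]|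
      = #|C| * #|D| + #|K| * (#|F|.-1 * #|D|))%N.
  move=> K cK; have F0 : (0 < #|F|)%N by apply/card_gt0P; exists 0.
  have KC : K \subset C by apply/subsetP => x; rewrite inE => /andP[].
  rewrite big_distrr /= (bigID (mem K)) /=.
  rewrite (eq_bigr (fun=> (#|F| * #|D|)%N)); last first.
    move=> x /andP[xC]; rewrite inE xC => /forall_inP xK; congr (_ * _)%N.
    by apply: eq_card => y; rewrite inE; case yD: (y \in D); rewrite //= xK.
  rewrite [X in (_ + X)%N](eq_bigr (fun=> #|D|)); last first.
    by move=> x /andP[xC xK]; rewrite -cK.
  have -> : (\sum_(x in C | x \in K) #|F| * #|D| = #|K| * (#|F| * #|D|))%N.
    rewrite -[RHS]sum_nat_const; apply: eq_bigl => x; apply/andP/idP => [[] //|xK].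
    by split; rewrite // (subsetP KC).
  have -> : (\sum_(x in C | x \notin K) #|D| = (#|C| - #|K|) * #|D|)%N.
    rewrite -(cardsDS KC) -[RHS]sum_nat_const.
    by apply: eq_bigl => x; rewrite in_setD andbC.
  have := leq_mul (subset_leq_card KC) (leqnn #|D|).
  rewrite mulnBl -{1}(prednK F0) mulSn mulnDr => /subnKC {2}<-.
  by rewrite addnAC.
move=> KA KB /count cA /count cB.
have exch : (\sum_(x in A) #|[set y in B | b x y == 0%R]|
           = \sum_(y in B) #|[set x in A | b x y == 0%R]|)%N.
  under eq_bigr => x _ do rewrite -sum1dep_card.
  under [RHS]eq_bigr => x _ do rewrite -sum1dep_card.
  rewrite (exchange_big_dep (mem B)) /=; last by move=> x y _ /andP[].
  by apply: eq_bigr => y yB; apply: eq_bigl => x; rewrite yB.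
(* The common factor |F| - 1 is cancelled, so it has to be positive. *)
have F1 : (1 < #|F|)%N := card_finNzRing_gt1 F.
move: cA cB; rewrite exch => -> /eqP; rewrite -/KA -/KB [(#|B| * #|A|)%N]mulnC.
rewrite eqn_add2l !(mulnCA _ #|F|.-1) eqn_pmul2l; first by move/eqP.
by rewrite -ltnS prednK // ltnW.
Qed.

(** Nondegeneracy of the trace form, tested on matrix units placed at a single index. *)
Lemma mxtrace_family_eq0 (R : pzRingType) (I : finType) (m n : I -> nat)
    (A : forall i, 'M[R]_(m i, n i)) :
  (forall W : {dffun forall i, 'M[R]_(n i, m i)}, \sum_i \tr (A i *m W i) = 0) ->
  forall i, A i = 0.
Proof.
move=> A0 i; apply/matrixP => x y; rewrite mxE.
(* The matrix sizes vary with [i'], so positions are compared as natural numbers. *)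
pose W := [ffun i' => (\matrix_(y', x')
  ((i' == i) && (y' == y :> nat) && (x' == x :> nat))%:R : 'M[R]_(n i', m i'))].
have := A0 W; rewrite (bigD1 i) //= big1 ?addr0 => [|i' /negPf ni]; last first.
  rewrite (_ : W i' = 0) ?mulmx0 ?mxtrace0 //.
  by apply/matrixP => a b; rewrite ffunE !mxE ni.
rewrite /mxtrace (bigD1 x) //= [X in _ + X]big1 ?addr0 => [|a ax]; last first.
  rewrite mxE big1 // => b _; rewrite ffunE !mxE eqxx /=.
  by rewrite -[a == x :> nat]/(a == x) (negPf ax) andbF mulr0.
rewrite mxE (bigD1 y) //= big1 ?addr0 => [|b bn]; last first.
  by rewrite ffunE !mxE -[b == y :> nat]/(b == y) (negPf bn) andbF mulr0.
by rewrite ffunE mxE !eqxx mulr1.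
Qed.

Lemma unitmx_inj (F : fieldType) (n : nat) (A : 'M[F]_n) :
  (forall v : 'rV_n, v *m A = 0 -> v = 0) -> A \in unitmx.
Proof.
move=> Ainj; rewrite -row_free_unit -kermx_eq0; apply/rowV0P => v /sub_kermxP.
exact: Ainj.
Qed.

(** The classical order of GL_n, with |F|^(n^2) pulled out so that the remaining factor is a
    polynomial in q = 1/|F|. *)
Lemma card_unitmx (F : finFieldType) (n : nat) (q := (#|F|%:R)^-1 : rat) :
  #|[pred A : 'M[F]_n | A \in unitmx]|%:R
    = #|{: 'M[F]_n}|%:R * (1 - q) ^+ n * qfact q n.
Proof.
have F1 : (1 < #|F|)%N := card_finNzRing_gt1 F.
have q0 : (#|F|%:R : rat) != 0 by rewrite pnatr_eq0 -lt0n ltnW.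
have -> : (#|[pred A : 'M[F]_n | A \in unitmx]|
   = #|F| ^ 'C(n, 2) * \prod_(1 <= i < n.+1) (#|F| ^ i - 1))%N.
  (* [card_GL] covers positive sizes; the empty matrix is counted by hand. *)
  case: n => [|n].
    rewrite big_nil (eq_card1 (x := 0)) // => A; rewrite [A]flatmx0 !inE.
    by rewrite eqxx unitmxE det_mx00 unitr1.
  rewrite -card_GL // cardsT card_sub; exact: eq_card.
rewrite card_mx natrM !natrX natr_prod.
rewrite (eq_bigr (fun i => #|F|%:R ^+ i - 1 : rat)); last first.
  by move=> i _; rewrite natrB ?natrX // expn_gt0 ltnW.
have q1 : (#|F|%:R : rat) != 1 by rewrite pnatr_eq1; move: F1; case: #|F| => [|[]].
rewrite /q; move: (#|F|%:R : rat) q0 q1 => p p0 p1 {F1 q}.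
rewrite /qfact; elim: n => [|n IH].
  by rewrite !big_nil bin_small // !expr0 !mulr1.
rewrite !(big_nat_recr n.+1) //= binS bin1 exprD mulrACA {}IH.
have -> : (n.+1 * n.+1 = n * n + (n + n.+1))%N by lia.
have -> : \sum_(s < n.+1) p^-1 ^+ s = (1 - p ^- n.+1) / (1 - p^-1).
  apply: (canRL (mulfK _)); first by rewrite subr_eq0 eq_sym invr_eq1.
  by rewrite mulrC -[LHS]opprK -mulNr opprB -subrX1 opprB exprVn.
rewrite !exprD !exprS; field.
by rewrite p0 expf_neq0 // subr_eq0 p1.
Qed.

Lemma square_bin2 n : (n ^ 2 = n + 2 * 'C(n, 2))%N.
Proof. by elim: n => // n IH; rewrite binS bin1; lia. Qed.

Definition psum (b : nat -> nat) (t : nat) : nat := (\sum_(j < t) b j)%N.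

(** The Euler form of one linear branch whose dimensions are partial sums. With B = [psum b m.+1]
    and c = [b m.+1], the induction step amounts to c(B+c) = c + C(B+c,2) - C(B,2) + C(c,2). *)
Lemma psum_quadratic (b : nat -> nat) (m : nat) :
  (\sum_(t < m.+1) psum b t.+1 ^ 2
     = \sum_(t < m) psum b t.+1 * psum b t.+2
       + psum b m.+1 + 'C(psum b m.+1, 2) + \sum_(t < m.+1) 'C(b t, 2))%N.
Proof.
elim: m => [|m IH].
  by rewrite !big_ord_recl !big_ord0 /psum big_ord_recl big_ord0 /= !addn0 square_bin2; lia.
rewrite big_ord_recr IH [in RHS]big_ord_recr [in X in _ = X]big_ord_recr /=.
have -> : psum b m.+2 = (psum b m.+1 + b m.+1)%N by rewrite /psum big_ord_recr.
set B := psum b m.+1; set c := b m.+1.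
have := square_bin2 B; have := square_bin2 c; have := square_bin2 (B + c)%N.
nia.
Qed.

(** * Orbit counting *)

Section ModuleCount.
Variables (F : finFieldType) (k l : nat) (M : 'M[nat]_(k, l)).
Local Notation Rep := (Rep F M).
Local Notation VertMaps := (VertMaps F M).
Implicit Types (g h X : VertMaps) (V W : Rep).

Definition vm_mul (g h : VertMaps) : VertMaps := [ffun t => g t *m h t].
Definition vm_inv (g : VertMaps) : VertMaps := [ffun t => invmx (g t)].
Definition vm_one : VertMaps := [ffun t => 1%:M].
Definition vm_unit : {set VertMaps} := [set g : VertMaps | [forall t, g t \in unitmx]].

(** Transport of structure, arranged so that [g] is an isomorphism from [V] to [act g V]; with row
    vectors it is a right action. *)
Definition act (g : VertMaps) (V : Rep) : Rep :=
  ([ffun e => invmx (g (lftv e)) *m V.1 e *m g (rgtv e)],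
   [ffun e => invmx (g (rgtv e)) *m V.2 e *m g (lftv e)]).

Definition Qpart_std (V : Rep) : bool :=
  [forall e : 'I_(nE k l), if fwd l e then V.1 e == VMR F M e else V.2 e == VML F M e].

Definition std_rep : Rep :=
  ([ffun e : 'I__ => VMR F M e], [ffun e : 'I__ => VML F M e]).

Lemma vm_unitP g : reflect (forall t, g t \in unitmx) (g \in vm_unit).
Proof. by rewrite inE; apply: forallP. Qed.

Lemma vm_unit1 : vm_one \in vm_unit.
Proof. by apply/vm_unitP => t; rewrite ffunE unitmx1. Qed.

Lemma vm_unitM g h : g \in vm_unit -> h \in vm_unit -> vm_mul g h \in vm_unit.
Proof.
move=> /vm_unitP gU /vm_unitP hU; apply/vm_unitP => t.
by rewrite ffunE unitmx_mul gU hU.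
Qed.

Lemma vm_unitV g : g \in vm_unit -> vm_inv g \in vm_unit.
Proof. by move=> /vm_unitP gU; apply/vm_unitP => t; rewrite ffunE unitmx_inv. Qed.

Lemma vm_mulA : associative vm_mul.
Proof. by move=> g h f; apply/ffunP => t; rewrite !ffunE mulmxA. Qed.

Lemma vm_mul1 : left_id vm_one vm_mul.
Proof. by move=> g; apply/ffunP => t; rewrite !ffunE mul1mx. Qed.

Lemma vm_mulr1 : right_id vm_one vm_mul.
Proof. by move=> g; apply/ffunP => t; rewrite !ffunE mulmx1. Qed.

Lemma vm_mulV g : g \in vm_unit -> vm_mul (vm_inv g) g = vm_one.
Proof. by move=> /vm_unitP gU; apply/ffunP => t; rewrite !ffunE mulVmx. Qed.

Lemma vm_mulrV g : g \in vm_unit -> vm_mul g (vm_inv g) = vm_one.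
Proof. by move=> /vm_unitP gU; apply/ffunP => t; rewrite !ffunE mulmxV. Qed.

Lemma act_fst g V e : (act g V).1 e = invmx (g (lftv e)) *m V.1 e *m g (rgtv e).
Proof. by rewrite ffunE. Qed.

Lemma act_snd g V e : (act g V).2 e = invmx (g (rgtv e)) *m V.2 e *m g (lftv e).
Proof. by rewrite ffunE. Qed.

Lemma act1 V : act vm_one V = V.
Proof.
case: V => V1 V2; congr pair; apply/ffunP => e;
  by rewrite !ffunE /= invmx1 mul1mx mulmx1.
Qed.

Lemma invmxM n (A B : 'M[F]_n) : A \in unitmx -> B \in unitmx ->
  invmx (A *m B) = invmx B *m invmx A.
Proof.
move=> Au Bu; have ABu : A *m B \in unitmx by rewrite unitmx_mul Au.
rewrite -[LHS]mulmx1; apply: (canLR (mulKmx ABu)).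
by rewrite mulmxA -[A *m B *m _]mulmxA mulmxV // mulmx1 mulmxV.
Qed.

Lemma invmx_conjM m n (A A' : 'M[F]_m) (B B' : 'M[F]_n)
    (X : 'M[F]_(m, n)) :
  A \in unitmx -> A' \in unitmx ->
  invmx (A *m A') *m X *m (B *m B') = invmx A' *m (invmx A *m X *m B) *m B'.
Proof. by move=> Au A'u; rewrite invmxM // !mulmxA. Qed.

Lemma actM g h V : g \in vm_unit -> h \in vm_unit ->
  act (vm_mul g h) V = act h (act g V).
Proof.
move=> /vm_unitP gU /vm_unitP hU.
congr pair; apply/ffunP => e; rewrite !ffunE /=.
  exact: invmx_conjM (gU (lftv e)) (hU (lftv e)).
exact: invmx_conjM (gU (rgtv e)) (hU (rgtv e)).
Qed.

Lemma actK g : g \in vm_unit -> cancel (act g) (act (vm_inv g)).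
Proof. by move=> gU V; rewrite -actM ?vm_unitV // vm_mulrV // act1. Qed.

Lemma actVK g : g \in vm_unit -> cancel (act (vm_inv g)) (act g).
Proof. by move=> gU V; rewrite -actM ?vm_unitV // vm_mulV // act1. Qed.

Lemma eq_invmx_conj m n (A : 'M[F]_m) (B : 'M[F]_n) (X Y : 'M[F]_(m, n)) :
  A \in unitmx -> (invmx A *m X *m B == Y) = (X *m B == A *m Y).
Proof.
move=> Au; rewrite -mulmxA; apply/eqP/eqP => [<-|->]; first by rewrite mulKVmx.
by rewrite mulKmx.
Qed.

Lemma is_isoE g V W : is_iso g V W = (g \in vm_unit) && (act g V == W).
Proof.
rewrite /is_iso /is_hom inE; have [gU|//] := boolP [forall t, g t \in unitmx].
move/forallP: gU => gU; rewrite !andTb; apply/forallP/eqP => [gh|<- e].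
  case: W gh => W1 W2 gh; congr pair; apply/ffunP => e; rewrite ffunE; apply/eqP;
    have /andP[h1 h2] := gh e.
    by rewrite (eq_invmx_conj _ _ _ (gU (lftv e))).
  by rewrite (eq_invmx_conj _ _ _ (gU (rgtv e))).
rewrite -(eq_invmx_conj _ _ _ (gU (lftv e))) -(eq_invmx_conj _ _ _ (gU (rgtv e))).
by rewrite !ffunE !eqxx.
Qed.

Lemma resQ_isoE V : resQ_iso_VM V = [exists g in vm_unit, Qpart_std (act g V)].
Proof.
apply: eq_existsb => g; rewrite inE; have [gU|//] := boolP [forall t, g t \in unitmx].
move/forallP: gU => gU; rewrite !andTb; apply: eq_forallb => e.
case: (fwd l e); rewrite ffunE.
  by rewrite (eq_invmx_conj _ _ _ (gU (lftv e))).
by rewrite (eq_invmx_conj _ _ _ (gU (rgtv e))).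
Qed.

Lemma mem_Aut V g : (g \in Aut V) = (g \in vm_unit) && (act g V == V).
Proof. by rewrite inE is_isoE. Qed.

Lemma iso_repP V W :
  reflect (exists2 g, g \in vm_unit & act g V = W) (iso_rep V W).
Proof.
apply: (iffP existsP) => [[g]|[g gU gV]].
  by rewrite is_isoE => /andP[gU /eqP gV]; exists g.
by exists g; rewrite is_isoE gU gV /=.
Qed.

(** Trace of [X] against the left-hand sides of the preprojective relations, regrouped by edges:
    each edge contributes one composite at each of its ends. *)
Definition relation_pairing (X : VertMaps) (V : Rep) : F :=
  \sum_(e < nE k l) (\tr (X (lftv e) *m termL V e) + \tr (X (rgtv e) *m termR V e)).

Lemma termL_at_edge V (e : 'I_(nE k l)) : termL_at V e = termL V e.
Proof.
(* The proof passed to the dependent [if] is generalized before its guard is destructed. *)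
case: e => s Hs; rewrite /termL_at; move: (erefl _); case: {2 3}(s < nE k l)%N => H.
  by rewrite (bool_irrelevance H Hs).
by rewrite Hs in H.
Qed.

Lemma termL_at_last V : termL_at V (nE k l) = 0.
Proof.
rewrite /termL_at; move: (erefl _); case: {2 3}(nE k l < nE k l)%N => H //.
by exfalso; rewrite ltnn in H.
Qed.

Lemma termR_at_edge V (e : 'I_(nE k l)) : termR_at V e.+1 = termR V e.
Proof.
case: e => s Hs; rewrite /termR_at; move: (erefl _); case: {2 3}(s < nE k l)%N => H.
  by rewrite (bool_irrelevance H Hs).
by rewrite Hs in H.
Qed.

#[local] Arguments termR_at : simpl never.

Lemma relation_pairingE X V :
  relation_pairing X V = \sum_t \tr (X t *m (termL_at V t + termR_at V t)).
Proof.
under eq_bigr => t _ do rewrite mulmxDr mxtraceD.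
rewrite big_split /= big_ord_recr /= [X in _ + X]big_ord_recl.
have -> : termR_at V (ord0 : 'I_(nE k l).+1) = 0 by [].
rewrite termL_at_last !mulmx0 !mxtrace0 addr0 add0r /relation_pairing big_split.
congr (_ + _); apply: eq_bigr => e _; first by rewrite -termL_at_edge.
have -> : lift ord0 e = rgtv e by apply: val_inj.
by rewrite -termR_at_edge.
Qed.

Lemma preprojP V : reflect (forall X, relation_pairing X V = 0) (preproj V).
Proof.
apply: (iffP forallP) => [V0 X|V0 t].
  by rewrite relation_pairingE big1 // => t _; rewrite (eqP (V0 t)) mulmx0 mxtrace0.
apply/eqP; move: t; apply: mxtrace_family_eq0 => X.
rewrite -[RHS](V0 X) relation_pairingE; apply: eq_bigr => t _.
by rewrite mxtrace_mulC.
Qed.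

(** Pairing the transported module with [X] equals pairing the original one with a conjugate of
    [X]. *)
Lemma preproj_act g V : g \in vm_unit -> preproj (act g V) = preproj V.
Proof.
have imp h W : h \in vm_unit -> preproj W -> preproj (act h W).
  move=> /vm_unitP hU /preprojP W0; apply/preprojP => X.
  pose Y : VertMaps := [ffun t => h t *m X t *m invmx (h t)].
  have tr_conj n (A B C H : 'M[F]_n) : H \in unitmx -> C = invmx H *m B *m H ->
      \tr (A *m C) = \tr (H *m A *m invmx H *m B).
    by move=> Hu ->; rewrite !mulmxA mxtrace_mulC !mulmxA.
  have mul_conj m n (A : 'M[F]_m) (B : 'M[F]_n) (S : 'M_(m, n)) (T : 'M_(n, m)) :
      B \in unitmx ->
      (invmx A *m S *m B) *m (invmx B *m T *m A) = invmx A *m (S *m T) *m A.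
    by move=> Bu; rewrite !mulmxA mulmxK.
  have mulN_conj n (A B : 'M[F]_n) : invmx A *m (- B) *m A = - (invmx A *m B *m A).
    by rewrite mulmxN mulNmx.
  rewrite -[RHS](W0 Y); apply: eq_bigr => e _; rewrite !ffunE; congr (_ + _).
    apply: tr_conj (hU (lftv e)) _; have := mul_conj _ _ (h (lftv e)) _
      (W.1 e) (W.2 e) (hU (rgtv e)).
    by rewrite /termL act_fst act_snd => ->; case: (fwd l e); rewrite // mulN_conj.
  apply: tr_conj (hU (rgtv e)) _; have := mul_conj _ _ (h (rgtv e)) _
    (W.2 e) (W.1 e) (hU (lftv e)).
  by rewrite /termR act_fst act_snd => ->; case: (fwd l e); rewrite // mulN_conj.
move=> gU; apply/idP/idP; last exact: imp.
by rewrite -{2}[V](actK gU); apply: imp; apply: vm_unitV.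
Qed.

(** * Reduction to modules whose Q-part is V_M *)

Definition std_structures : {set Rep} := [set V : Rep | preproj V && Qpart_std V].
(** This is Aut_kQ(V_M), as the stabilizer of the Q-part of V_M. *)
Definition std_aut : {set VertMaps} := [set g in vm_unit | Qpart_std (act g std_rep)].

Lemma Qpart_std_rep : Qpart_std std_rep.
Proof. by apply/forallP => e; rewrite !ffunE !eqxx; case: ifP. Qed.

(** The action does not mix the two directions of an edge, so the new Q-part depends on the old
    Q-part alone. *)
Lemma Qpart_act g V : Qpart_std V -> Qpart_std (act g V) = Qpart_std (act g std_rep).
Proof.
move=> /forallP V0; apply: eq_forallb => e; have := V0 e.
by case: (fwd l e) => /eqP Ve; rewrite ?act_fst ?act_snd Ve ffunE.
Qed.

Lemma mem_std_structures V :
  (V \in std_structures) = preproj V && Qpart_std V.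
Proof. by rewrite inE. Qed.

Lemma mem_std_aut g :
  (g \in std_aut) = (g \in vm_unit) && Qpart_std (act g std_rep).
Proof. by rewrite inE. Qed.

Lemma vm_mulKV g h : g \in vm_unit -> vm_mul g (vm_mul (vm_inv g) h) = h.
Proof. by move=> gU; rewrite vm_mulA vm_mulrV // vm_mul1. Qed.

Lemma vm_mulK g h : g \in vm_unit -> vm_mul (vm_inv g) (vm_mul g h) = h.
Proof. by move=> gU; rewrite vm_mulA vm_mulV // vm_mul1. Qed.

Lemma mem_admissible V :
  (V \in admissible F M) = preproj V && [exists g in vm_unit, Qpart_std (act g V)].
Proof. by rewrite inE resQ_isoE. Qed.

(* Both sides count the pairs (V, g) where g carries the Q-part of the
   preprojective module V to V_M. *)
Lemma card_admissible :
  (#|admissible F M| * #|std_aut| = #|vm_unit| * #|std_structures|)%N.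
Proof.
pose P := [set x : Rep * VertMaps |
  [&& preproj x.1, x.2 \in vm_unit & Qpart_std (act x.2 x.1)]].
have memP V g : ((V, g) \in P) = [&& preproj V, g \in vm_unit & Qpart_std (act g V)].
  by rewrite inE.
transitivity #|P|.
  apply/esym/(card_fibers (f := fst)) => [[V g]|V].
    rewrite memP mem_admissible => /and3P[-> gU gV] /=.
    by apply/existsP; exists g; rewrite gU.
  rewrite mem_admissible => /andP[pV /existsP[g0 /andP[g0U g0V]]].
  (* The elements that bring [V] to standard form are the coset of [std_aut] through [g0]. *)
  apply: (card_bij_in (f := fun x => vm_mul (vm_inv g0) x.2)
                      (g := fun h => (V, vm_mul g0 h))).
  - case=> V' g; rewrite in_set memP /= => /andP[/and3P[_ gU gV] /eqP VV'].
    subst V'; rewrite mem_std_aut vm_unitM ?vm_unitV //=.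
    by rewrite -(Qpart_act _ g0V) -actM ?vm_unitM ?vm_unitV // vm_mulKV.
  - move=> h; rewrite mem_std_aut in_set memP /= pV eqxx andbT => /andP[hU hV].
    by rewrite (vm_unitM g0U hU) (actM _ g0U hU) (Qpart_act _ g0V).
  - by case=> V' g; rewrite in_set memP /= => /andP[_ /eqP->]; rewrite vm_mulKV.
  - by move=> h _ /=; rewrite vm_mulK.
apply: (card_fibers (f := snd)) => [[V g]|g gU]; first by rewrite memP => /and3P[].
(* For fixed [g], transport along [g] identifies the fiber with [std_structures]. *)
apply: (card_bij_in (f := fun x => act x.2 x.1)
                    (g := fun V => (act (vm_inv g) V, g))).
- case=> V h; rewrite in_set memP /= => /andP[/and3P[pV hU hV] _].
  by rewrite mem_std_structures preproj_act // pV.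
- move=> V; rewrite mem_std_structures in_set memP /= => /andP[pV VQ].
  by rewrite preproj_act ?vm_unitV // pV gU eqxx actVK // VQ.
- case=> V h; rewrite in_set memP /= => /andP[/and3P[pV hU hV] /eqP->].
  by rewrite actK.
- by move=> V _ /=; rewrite actVK.
Qed.

Lemma admissible_act g V :
  g \in vm_unit -> V \in admissible F M -> act g V \in admissible F M.
Proof.
rewrite !mem_admissible => gU /andP[pV /existsP[h /andP[hU hV]]].
rewrite preproj_act // pV; apply/existsP; exists (vm_mul (vm_inv g) h).
by rewrite vm_unitM ?vm_unitV //= -actM ?vm_unitM ?vm_unitV // vm_mulKV.
Qed.

Lemma iso_rep_equivalence : equivalence_rel (@iso_rep F k l M).
Proof.
apply/equivalence_relP; split=> [V|V W /iso_repP[g gU <-] U].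
  by apply/iso_repP; exists vm_one; rewrite ?vm_unit1 ?act1.
apply/iso_repP/iso_repP => [] [h hU <-].
  by exists (vm_mul (vm_inv g) h); rewrite ?vm_unitM ?vm_unitV // actM ?vm_unitV // actK.
by exists (vm_mul g h); rewrite ?vm_unitM // actM.
Qed.

(** Orbit-stabilizer: the fibers of [g] mapped to [act g V] are cosets of [Aut V]. *)
Lemma card_iso_class V : V \in admissible F M ->
  (#|[set W in admissible F M | iso_rep V W]| * #|Aut V| = #|vm_unit|)%N.
Proof.
move=> Vadm; apply/esym/(card_fibers (f := fun g => act g V)) => [g gU|W].
  by rewrite inE admissible_act //; apply/iso_repP; exists g.
rewrite inE => /andP[_ /iso_repP[g0 g0U <-]].
apply: (card_bij_in (f := fun g => vm_mul g (vm_inv g0)) (g := fun h => vm_mul h g0)).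
- move=> g; rewrite in_set mem_Aut => /andP[gU /eqP gV].
  by rewrite vm_unitM ?vm_unitV //= actM ?vm_unitV // gV actK.
- move=> h; rewrite in_set mem_Aut => /andP[hU /eqP hV].
  by rewrite vm_unitM //= actM // hV.
- by move=> g _; rewrite -vm_mulA vm_mulV // vm_mulr1.
- by move=> g _; rewrite -vm_mulA vm_mulrV // vm_mulr1.
Qed.

Lemma sum_inv_autE : sum_inv_aut F M = #|admissible F M|%:R / #|vm_unit|%:R.
Proof.
have equiv : {in admissible F M & &, equivalence_rel (@iso_rep F k l M)}.
  by move=> U V W _ _ _; apply: iso_rep_equivalence.
have := equivalence_partitionP equiv; rewrite -/(isoclasses F M) => part.
rewrite (card_partition part) natr_sum mulr_suml; apply: eq_bigr => C CP.
have vm0 : (0 < #|vm_unit|)%N by apply/card_gt0P; exists vm_one; apply: vm_unit1.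
(* Blocks of a partition are nonempty, so [pick] never falls to its default 0. *)
have C0 : C != set0.
  by apply: contraTneq CP => ->; have /and3P[] := part.
case: pickP => [V VC|C1]; last by case/set0Pn: C0 => V; rewrite C1.
have Vadm : V \in admissible F M.
  by rewrite -(cover_partition part); apply/bigcupP; exists C.
have -> : C = [set W in admissible F M | iso_rep V W].
  have /and3P[_ triv _] := part; rewrite -(def_pblock triv CP VC).
  apply/setP => W; rewrite inE.
  have [Wadm|Wadm] := boolP (W \in admissible F M).
    exact: pblock_equivalence_partition.
  apply: contraNF Wadm; rewrite (def_pblock triv CP VC) => WC.
  by rewrite -(cover_partition part); apply/bigcupP; exists C.
have := card_iso_class Vadm; set m := #|_|; move=> E.
have : m != 0%N by apply: contraTneq vm0 => m0; rewrite -E m0.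
rewrite -E natrM => m0.
by rewrite invfM mulrA divff ?mul1r // pnatr_eq0.
Qed.

Lemma vm_unit_neq0 : #|vm_unit|%:R != 0 :> rat.
Proof.
by rewrite pnatr_eq0 -lt0n; apply/card_gt0P; exists vm_one; apply: vm_unit1.
Qed.

Lemma sum_inv_aut_std : sum_inv_aut F M = #|std_structures|%:R / #|std_aut|%:R.
Proof.
rewrite sum_inv_autE; apply/eqP; rewrite eqr_div ?vm_unit_neq0 //; last first.
  rewrite pnatr_eq0 -lt0n; apply/card_gt0P; exists vm_one.
  by rewrite mem_std_aut vm_unit1 act1 Qpart_std_rep.
by rewrite -!natrM card_admissible mulnC.
Qed.

End ModuleCount.

(** * Duality between preprojective structures and endomorphisms *)

Section Pairing.
Variables (F : finFieldType) (k l : nat) (M : 'M[nat]_(k, l)).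
Local Notation Rep := (Rep F M).
Local Notation VertMaps := (VertMaps F M).
Implicit Types (g h X Y : VertMaps) (U V W : Rep).

Definition Qend g : bool :=
  [forall e : 'I_(nE k l),
    if fwd l e then VMR F M e *m g (rgtv e) == g (lftv e) *m VMR F M e
    else VML F M e *m g (lftv e) == g (rgtv e) *m VML F M e].

Definition std_end : {set VertMaps} := [set g | Qend g].
Definition Qpart_std_set : {set Rep} := [set V : Rep | Qpart_std V].

Lemma std_autE : std_aut F M = [set g in vm_unit F M | g \in std_end].
Proof.
apply/setP => g; rewrite mem_std_aut [in RHS]in_set.
have [/vm_unitP gU|//] := boolP (g \in vm_unit F M); rewrite !andTb inE.
apply: eq_forallb => e; rewrite act_fst act_snd; case: (fwd l e); rewrite ffunE.
  exact: eq_invmx_conj (gU (lftv e)).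
exact: eq_invmx_conj (gU (rgtv e)).
Qed.

(* [comm1] and [comm2] are the commutators of [X] with the arrows of V_M; they
   compute [relation_pairing] on the modules whose Q-part is V_M. *)
Definition comm1 X (e : 'I_(nE k l)) : 'M[F]_(pdim M e.+1, pdim M e) :=
  if fwd l e then 0 else X (rgtv e) *m VML F M e - VML F M e *m X (lftv e).
Definition comm2 X (e : 'I_(nE k l)) : 'M[F]_(pdim M e, pdim M e.+1) :=
  if fwd l e then X (lftv e) *m VMR F M e - VMR F M e *m X (rgtv e) else 0.
Definition comm_pairing X V : F :=
  \sum_(e < nE k l) (\tr (comm1 X e *m V.1 e) + \tr (comm2 X e *m V.2 e)).

Lemma mxtrace_commutator m n (A : 'M[F]_(m, n)) (B : 'M[F]_(n, m))
    (X : 'M[F]_m) (Y : 'M[F]_n) :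
  \tr (X *m (A *m B)) - \tr (Y *m (B *m A)) = \tr ((X *m A - A *m Y) *m B).
Proof.
rewrite mulmxBl raddfB /=; congr (_ - _); rewrite ?mulmxA //.
by rewrite [RHS]mxtrace_mulC mulmxA [RHS]mxtrace_mulC mulmxA.
Qed.

Lemma comm_pairingE X V : Qpart_std V -> relation_pairing X V = comm_pairing X V.
Proof.
move=> /forallP VQ; apply: eq_bigr => e _; have := VQ e.
rewrite /termL /termR /comm1 /comm2; case: (fwd l e) => /eqP Ve.
  rewrite mul0mx mxtrace0 add0r -Ve mulmxN raddfN /=.
  exact: (mxtrace_commutator _ _ (X (lftv e)) (X (rgtv e))).
rewrite mul0mx mxtrace0 addr0 -Ve mulmxN raddfN addrC /=.
exact: (mxtrace_commutator _ _ (X (rgtv e)) (X (lftv e))).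
Qed.

(** Translation of [W] by a multiple of [V]; with [vm_axpy] it provides the maps required by
    [card_translates]. *)
Definition rep_axpy (a : F) V W : Rep :=
  ([ffun e => W.1 e + a *: V.1 e], [ffun e => W.2 e + a *: V.2 e]).
Definition vm_axpy (a : F) X Y : VertMaps := [ffun t => Y t + a *: X t].

Lemma rep_axpyK a V : cancel (rep_axpy a V) (rep_axpy (- a) V).
Proof.
by case=> W1 W2; congr pair; apply/ffunP => e; rewrite !ffunE /= scaleNr addrK.
Qed.

Lemma vm_axpyK a X : cancel (vm_axpy a X) (vm_axpy (- a) X).
Proof. by move=> Y; apply/ffunP => e; rewrite !ffunE scaleNr addrK. Qed.

Lemma comm_pairing_axpy X a V W :
  comm_pairing X (rep_axpy a V W) = comm_pairing X W + a * comm_pairing X V.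
Proof.
rewrite /comm_pairing mulr_sumr -big_split; apply: eq_bigr => e _ /=.
rewrite !ffunE !mulmxDr -!scalemxAr !raddfD /= !linearZ /=; ring.
Qed.

Lemma relation_pairing_axpy a X Y V :
  relation_pairing (vm_axpy a X Y) V
    = relation_pairing Y V + a * relation_pairing X V.
Proof.
rewrite /relation_pairing mulr_sumr -big_split; apply: eq_bigr => e _ /=.
rewrite !ffunE !mulmxDl -!scalemxAl !raddfD /= !linearZ /=; ring.
Qed.

Definition set_Qpart (U V : Rep) : Rep :=
  ([ffun e : 'I_(nE k l) => if fwd l e then U.1 e else V.1 e],
   [ffun e : 'I_(nE k l) => if fwd l e then V.2 e else U.2 e]).

(** On each edge the commutator paired with the arrow of Q is zero by definition, so only the
    reverse arrows are seen. *)
Lemma comm_pairing_set_Qpart X U V :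
  comm_pairing X (set_Qpart U V) = comm_pairing X V.
Proof.
apply: eq_bigr => e _; rewrite !ffunE /comm1 /comm2.
by case: (fwd l e); rewrite !mul0mx.
Qed.

Lemma std_end_comm X :
  (X \in std_end) <-> (forall e, comm1 X e = 0) /\ (forall e, comm2 X e = 0).
Proof.
rewrite inE; split=> [/forallP XQ|[X1 X2]].
  split=> e; have := XQ e; rewrite /comm1 /comm2; case: (fwd l e) => //= /eqP ->;
  exact: subrr.
apply/forallP => e; have := X1 e; have := X2 e; rewrite /comm1 /comm2.
by case: (fwd l e) => [/eqP + _|_ /eqP]; rewrite subr_eq0 eq_sym.
Qed.

(** End_kQ(V_M) is the left radical of the pairing: the reverse arrows are arbitrary, so
    nondegeneracy of the trace form forces the commutators to vanish. *)
Lemma std_endP X :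
  reflect (forall V, Qpart_std V -> relation_pairing X V = 0) (X \in std_end).
Proof.
apply: (iffP idP) => [/std_end_comm[X1 X2] V VQ|X0].
  rewrite comm_pairingE // /comm_pairing big1 // => e _.
  by rewrite X1 X2 !mul0mx !mxtrace0 addr0.
(* Resetting the Q-part to V_M extends the vanishing to all [V], which may then be nonzero in one
   component only. *)
have {}X0 V : comm_pairing X V = 0.
  have VQ : Qpart_std (set_Qpart (std_rep F M) V).
    by apply/forallP => e; rewrite !ffunE; case: (fwd l e); rewrite eqxx.
  by rewrite -(comm_pairing_set_Qpart X (std_rep F M) V) -comm_pairingE ?X0.
apply/std_end_comm; split; apply: mxtrace_family_eq0 => W.
  rewrite -[RHS](X0 (W, [ffun=> 0])); apply: eq_bigr => e _.
  by rewrite ffunE mulmx0 mxtrace0 addr0.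
rewrite -[RHS](X0 ([ffun=> 0], W)); apply: eq_bigr => e _.
by rewrite ffunE mulmx0 mxtrace0 add0r.
Qed.

(** [card_radicals] with left radical End_kQ(V_M) and right radical the preprojective structures on
    V_M. *)
Lemma card_std_end :
  (#|std_end| * #|Qpart_std_set| = #|std_structures F M| * #|{: VertMaps}|)%N.
Proof.
have := @card_radicals F _ _ [set: VertMaps] Qpart_std_set (@relation_pairing F k l M).
rewrite cardsT /=.
set KA := [set u in _ | _]; set KB := [set u in Qpart_std_set | _].
have KAE : KA = std_end.
  apply/setP => X; rewrite [LHS]in_set in_setT andTb.
  apply/forall_inP/std_endP => X0 V VQ.
    by apply/eqP/X0; rewrite in_set.
  by rewrite X0 //; move: VQ; rewrite in_set.
have KBE : KB = std_structures F M.
  apply/setP => V; rewrite mem_std_structures [LHS]in_set [V \in _]in_set andbC.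
  congr (_ && _).
  apply/forall_inP/preprojP => V0 X; first by apply/eqP/V0; rewrite in_setT.
  by rewrite V0.
rewrite {}KAE {}KBE => {KA KB} H; apply: H => [X _ XK|V VQ VK].
  have [V VQ VX] : exists2 V, Qpart_std V & relation_pairing X V != 0.
    apply/exists_inP; rewrite -[X in is_true X]negbK negb_exists_in.
    apply: contra XK => /forall_inP X0; apply/std_endP => V /X0.
    by rewrite negbK => /eqP.
  (* [Qpart_std_set] is an affine space. Its directions have zero Q-part, so [V] itself is replaced
     by [D], which has the same commutator pairing. *)
  pose D := set_Qpart ([ffun=> 0], [ffun=> 0]) V.
  have DQ W a : W \in Qpart_std_set -> rep_axpy a D W \in Qpart_std_set.
    rewrite !in_set => /forallP WQ; apply/forallP => e; have := WQ e.
    by rewrite !ffunE; case: (fwd l e); rewrite scaler0 addr0.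
  (* The scaling makes the pairing increase by exactly [a]. *)
  apply: (card_translates (tr := fun a => rep_axpy (a / relation_pairing X V) D)).
  - by move=> W WQ a; apply: DQ.
  - by move=> a W; rewrite mulNr rep_axpyK.
  - move=> W WQ a; rewrite comm_pairingE; last first.
      by have := DQ W (a / relation_pairing X V) WQ; rewrite in_set.
    rewrite comm_pairing_axpy comm_pairing_set_Qpart -!comm_pairingE ?divfK //.
    by rewrite in_set in WQ.
have [X XV] : exists X, relation_pairing X V != 0.
  apply/existsP; rewrite -[X in is_true X]negbK negb_exists.
  apply: contra VK => /forallP V0; rewrite in_set in VQ.
  rewrite mem_std_structures VQ andbT; apply/preprojP => X.
  by apply/eqP; have := V0 X; rewrite negbK.
rewrite -cardsT.
apply: (card_translates (tr := fun a => vm_axpy (a / relation_pairing X V) X)).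
- by move=> *; rewrite in_setT.
- by move=> a Y; rewrite mulNr vm_axpyK.
- by move=> Y _ a; rewrite relation_pairing_axpy divfK.
Qed.

Lemma card_Qpart_std_set :
  #|Qpart_std_set| = (#|F| ^ \sum_(e < nE k l) pdim M e * pdim M e.+1)%N.
Proof.
(* On each edge one direction is prescribed and the other is a free matrix. *)
pose P1 (e : 'I_(nE k l)) := [pred A : 'M[F]_(pdim M e, pdim M e.+1) |
  fwd l e ==> (A == VMR F M e)].
pose P2 (e : 'I_(nE k l)) := [pred A : 'M[F]_(pdim M e.+1, pdim M e) |
  fwd l e || (A == VML F M e)].
transitivity #|setX [set f : {dffun forall e : 'I_(nE k l), 'M[F]_(pdim M e, pdim M e.+1)} |
     [forall e, P1 e (f e)]]
   [set f : {dffun forall e : 'I_(nE k l), 'M[F]_(pdim M e.+1, pdim M e)} |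
     [forall e, P2 e (f e)]]|.
  apply: eq_card => -[V1 V2]; rewrite !in_set /=; apply/forallP/andP.
    move=> VQ; split; apply/forallP => e; have := VQ e => /=; by case: (fwd l e).
  by move=> [/forallP VQ1 /forallP VQ2] e; have := VQ1 e; have := VQ2 e => /=;
    case: (fwd l e).
rewrite cardsX.
rewrite (@card_dep_family _ (fun e : 'I_(nE k l) =>
  'M[F]_(pdim M e, pdim M e.+1) : finType) P1).
rewrite (@card_dep_family _ (fun e : 'I_(nE k l) =>
  'M[F]_(pdim M e.+1, pdim M e) : finType) P2).
rewrite -big_split /= expn_sum.
apply: eq_bigr => e _; rewrite -[RHS]mul1n; case fe: (fwd l e).
  congr (_ * _)%N; last rewrite mulnC -card_mx.
    by rewrite -(card1 (VMR F M e)); apply: eq_card => A; rewrite !inE fe.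
  by apply: eq_card => A; rewrite !inE fe.
rewrite mulnC; congr (_ * _)%N; last rewrite -card_mx.
  by rewrite -(card1 (VML F M e)); apply: eq_card => A; rewrite !inE fe.
by apply: eq_card => A; rewrite !inE fe.
Qed.

Lemma card_VertMaps : #|{: VertMaps}| = (#|F| ^ \sum_(t < (nE k l).+1) pdim M t ^ 2)%N.
Proof.
rewrite card_dep_ffun foldrE big_image /= expn_sum.
by apply: eq_bigr => t _; rewrite card_mx.
Qed.

End Pairing.

(** * Endomorphisms of V_M *)

Section Blocks.
Variables (F : finFieldType) (k l : nat) (M : 'M[nat]_(k, l)).
Hypotheses (k_gt0 : (0 < k)%N) (l_gt0 : (0 < l)%N).
Local Notation VertMaps := (VertMaps F M).
Local Notation label := ('I_k * 'I_l * 'I_(Mbound M))%type.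
Local Notation blocks := {dffun forall ij : 'I_k * 'I_l, 'M[F]_(M ij.1 ij.2)}.
Implicit Types (g h : VertMaps) (b : label) (d : blocks) (ij : 'I_k * 'I_l).

Definition bval t (x : 'I_(pdim M t)) : label := @enum_val _ (mem (Bset M t)) x.

Lemma bval_in t (x : 'I_(pdim M t)) : bval x \in Bset M t.
Proof. exact: enum_valP. Qed.

Lemma bval_inj t : injective (@bval t).
Proof. exact: enum_val_inj. Qed.

Lemma bvalP t b : b \in Bset M t -> exists x : 'I_(pdim M t), bval x = b.
Proof. by move=> bt; exists (enum_rank_in bt b); apply: enum_rankK_in. Qed.

Lemma sum_Bset t (f : label -> F) :
  \sum_(b in Bset M t) f b = \sum_(x < pdim M t) f (bval x).
Proof. exact: big_enum_val. Qed.

(* Zero when one of the two labels does not occur at the vertex [t]. *)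
Definition ent t (A : 'M[F]_(pdim M t)) b b' : F :=
  \sum_x \sum_y (if (bval x == b) && (bval y == b') then A x y else 0).

Lemma ent_bval t (A : 'M[F]_(pdim M t)) x y : ent A (bval x) (bval y) = A x y.
Proof.
rewrite /ent (bigD1 x) //= [X in _ + X]big1 ?addr0 => [|x' nx].
  rewrite (bigD1 y) //= [X in _ + X]big1 ?addr0 ?eqxx // => y' ny.
  by rewrite (inj_eq (@bval_inj t)) (negPf ny) andbF.
by rewrite big1 // => y' _; rewrite (inj_eq (@bval_inj t)) (negPf nx).
Qed.

Lemma ent_neq0 t (A : 'M[F]_(pdim M t)) b b' :
  ent A b b' != 0 -> b \in Bset M t /\ b' \in Bset M t.
Proof.
move=> Ab; have [x xb|nb] := pickP (fun x : 'I_(pdim M t) => bval x == b); last first.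
  by rewrite /ent big1 ?eqxx // in Ab => x _; rewrite big1 // => y _; rewrite nb.
have [y yb|nb'] := pickP (fun x : 'I_(pdim M t) => bval x == b'); last first.
  rewrite /ent big1 ?eqxx // in Ab => x' _; rewrite big1 // => y _.
  by rewrite nb' andbF.
by rewrite -(eqP xb) -(eqP yb) !bval_in.
Qed.

Lemma ent_mul t (A A' : 'M[F]_(pdim M t)) b b' :
  ent (A *m A') b b' = \sum_(b'' in Bset M t) ent A b b'' * ent A' b'' b'.
Proof.
have [bt|bt] := boolP (b \in Bset M t); last first.
  rewrite big1 => [|b'' _].
    by apply/eqP; apply: contraNT bt => /ent_neq0[].
  have /eqP-> : ent A b b'' == 0 by apply: contraNT bt => /ent_neq0[].
  exact: mul0r.
have [bt'|bt'] := boolP (b' \in Bset M t); last first.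
  rewrite big1 => [|b'' _].
    by apply/eqP; apply: contraNT bt' => /ent_neq0[].
  have /eqP-> : ent A' b'' b' == 0 by apply: contraNT bt' => /ent_neq0[].
  exact: mulr0.
have [[x <-] [y <-]] := (bvalP bt, bvalP bt').
rewrite ent_bval mxE sum_Bset; apply: eq_bigr => z _.
by rewrite !ent_bval.
Qed.

Lemma entD t (A A' : 'M[F]_(pdim M t)) b b' :
  ent (A + A') b b' = ent A b b' + ent A' b b'.
Proof.
rewrite /ent -big_split; apply: eq_bigr => x _; rewrite -big_split /=.
by apply: eq_bigr => y _; case: ifP => _; rewrite ?mxE ?addr0.
Qed.

Lemma ent1 t b b' : b \in Bset M t -> b' \in Bset M t ->
  ent (1%:M : 'M[F]_(pdim M t)) b b' = (b == b')%:R.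
Proof.
move=> /bvalP[x <-] /bvalP[y <-].
by rewrite ent_bval mxE (inj_eq (@bval_inj t)).
Qed.

(** Common form of [VMR] and [VML], so that both orientations share one commutation criterion. *)
Definition label_mx t t' : 'M[F]_(pdim M t, pdim M t') :=
  \matrix_(x, y) (bval x == bval y)%:R.

Lemma label_mx_comm t t' (A : 'M[F]_(pdim M t)) (A' : 'M[F]_(pdim M t')) :
  label_mx t t' *m A' = A *m label_mx t t' <->
  (forall b b', b \in Bset M t -> b' \in Bset M t' -> ent A' b b' = ent A b b').
Proof.
have JA x z : (label_mx t t' *m A') x z = ent A' (bval x) (bval z).
  rewrite mxE /ent; apply: eq_bigr => y _; rewrite (bigD1 z) //= big1 ?addr0 => [|y' ny].
    by rewrite mxE eqxx andbT eq_sym; case: eqP => _; rewrite ?mul1r ?mul0r.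
  by rewrite (inj_eq (@bval_inj t')) (negPf ny) andbF.
have AJ x z : (A *m label_mx t t') x z = ent A (bval x) (bval z).
  rewrite mxE /ent [RHS](bigD1 x) //= [X in _ + X]big1 ?addr0 => [|x' nx].
    apply: eq_bigr => y _; rewrite mxE eqxx.
    by case: eqP => _; rewrite ?mulr1 ?mulr0.
  by rewrite big1 // => y _; rewrite (inj_eq (@bval_inj t)) (negPf nx).
split=> [E b b' /bvalP[x <-] /bvalP[z <-]|E]; first by rewrite -JA E AJ.
by apply/matrixP => x z; rewrite JA AJ E ?bval_in.
Qed.

Lemma mem_Bset t b : (b \in Bset M t)
  = [&& (b.2 < M b.1.1 b.1.2)%N, (b.1.2 <= t)%N & (t <= nE k l - b.1.1)%N].
Proof. by rewrite inE. Qed.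

Lemma center_subproof : (l.-1 < (nE k l).+1)%N.
Proof. by rewrite /nE; lia. Qed.
(** The vertex 0 of Q, the sink of the quiver; every V_(i,j) is supported there. *)
Definition center : 'I_(nE k l).+1 := Ordinal center_subproof.

Lemma Bset_center t b : b \in Bset M t -> b \in Bset M l.-1.
Proof.
rewrite !mem_Bset => /and3P[-> _ _] /=; rewrite /nE.
by have := ltn_ord b.1.1; have := ltn_ord b.1.2; lia.
Qed.

Lemma Bset_fwd (e : 'I_(nE k l)) b : fwd l e -> b \in Bset M e -> b \in Bset M e.+1.
Proof.
rewrite !mem_Bset /fwd /nE => el /and3P[-> ? ?] /=.
by have := ltn_ord b.1.1; have := ltn_ord b.1.2; lia.
Qed.

Lemma Bset_bwd (e : 'I_(nE k l)) b : ~~ fwd l e -> b \in Bset M e.+1 -> b \in Bset M e.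
Proof.
rewrite !mem_Bset /fwd /nE => el /and3P[-> ? ?] /=.
by have := ltn_ord b.1.1; have := ltn_ord b.1.2; lia.
Qed.

Lemma QendP g : g \in std_end F M <-> forall (e : 'I_(nE k l)) b b',
  if fwd l e then b \in Bset M e -> b' \in Bset M e.+1 ->
    ent (g (rgtv e)) b b' = ent (g (lftv e)) b b'
  else b \in Bset M e.+1 -> b' \in Bset M e ->
    ent (g (lftv e)) b b' = ent (g (rgtv e)) b b'.
Proof.
rewrite inE; split=> [/forallP gQ e b b'|gQ].
  have := gQ e; case: (fwd l e) => /eqP E; apply: (iffLR (label_mx_comm _ _)) => //.
apply/forallP => e; have := gQ e.
by case: (fwd l e) => {}gQ; apply/eqP; apply: (iffRL (label_mx_comm _ _)) => // b b';
  apply: gQ.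
Qed.

Lemma ent_eq0_out t (A : 'M[F]_(pdim M t)) b b' : b' \notin Bset M t -> ent A b b' = 0.
Proof. by move=> bt; apply/eqP; apply: contraNT bt => /ent_neq0[]. Qed.

(** A label missing at the target of an arrow of Q is also missing at its source, and then both
    entries are zero; otherwise [QendP] applies. *)
Lemma ent_edge g (e : 'I_(nE k l)) b b' : g \in std_end F M ->
  b \in Bset M e -> b \in Bset M e.+1 ->
  ent (g (lftv e)) b b' = ent (g (rgtv e)) b b'.
Proof.
move=> /QendP/(_ e b b') + be be'; have := @Bset_fwd e b'; have := @Bset_bwd e b'.
case: (fwd l e) => /=.
  move=> _ /(_ isT) b'S gQ; have [b'e|b'e] := boolP (b' \in Bset M e.+1).
    by rewrite gQ.
  by rewrite !ent_eq0_out //; apply: contra b'e.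
move=> /(_ isT) b'S _ gQ; have [b'e|b'e] := boolP (b' \in Bset M e).
  by rewrite gQ.
by rewrite !ent_eq0_out //; apply: contra b'e.
Qed.

(** The support of [b] is an interval containing the center, so [ent_edge] can be iterated from [t]
    to the center. *)
Lemma ent_center g (t : 'I_(nE k l).+1) b b' : g \in std_end F M ->
  b \in Bset M t -> ent (g t) b b' = ent (g center) b b'.
Proof.
move=> gE bt; pose G s := ent (g (inord s)) b b'.
have GE (s : 'I_(nE k l).+1) : ent (g s) b b' = G s by rewrite /G inord_val.
have Bint s : (b \in Bset M s) = (b.1.2 <= s <= nE k l - b.1.1)%N.
  by move: bt; rewrite !mem_Bset => /and3P[-> _ _].
have step s : (s < nE k l)%N -> b \in Bset M s -> b \in Bset M s.+1 -> G s = G s.+1.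
  move=> sE bs bs1; have := @ent_edge g (Ordinal sE) b b' gE bs bs1.
  by rewrite !GE.
have bl := Bset_center bt; rewrite !GE /=.
have up n s : (s + n = l.-1)%N -> b \in Bset M s -> G s = G l.-1.
  elim: n s => [|n IH] s; first by rewrite addn0 => ->.
  move=> sn bs; rewrite -(IH s.+1); [apply: step => // | lia |].
  - by have := center_subproof; lia.
  - by move: bs bl; rewrite !Bint; lia.
  - by move: bs bl; rewrite !Bint; lia.
have down n s : (s = l.-1 + n)%N -> b \in Bset M s -> G s = G l.-1.
  elim: n s => [|n IH] s; first by rewrite addn0 => ->.
  move=> sn bs; rewrite sn addnS -(IH (l.-1 + n)%N) //.
    apply/esym/step; move: bs bl; rewrite !Bint; lia.
  by move: bs bl; rewrite !Bint; lia.
have [tl|lt] := leqP t l.-1; first by apply: (up (l.-1 - t)%N); rewrite ?subnKC.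
by apply: (down (t - l.-1)%N); rewrite ?subnKC // ltnW.
Qed.

(** By [ent_center] the entry is nonzero at every vertex in the support of [b], so that support lies
    inside the support of [b']. Comparing the two endpoints gives the inequalities. *)
Lemma ent_triangular g b b' : g \in std_end F M -> ent (g center) b b' != 0 ->
  (b'.1.1 <= b.1.1)%N /\ (b'.1.2 <= b.1.2)%N.
Proof.
move=> gE gb; have [bl b'l] := ent_neq0 gb.
have tB s : (b.1.2 <= s <= nE k l - b.1.1)%N -> b' \in Bset M s.
  move=> bs; have sE : (s < (nE k l).+1)%N by lia.
  have bt : b \in Bset M (Ordinal sE).
    by move: bl; rewrite !mem_Bset => /and3P[-> _ _].
  by move: gb; rewrite -(ent_center _ gE bt) => /ent_neq0[].
have bb : (b.1.2 <= nE k l - b.1.1)%N.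
  by move: bl; rewrite mem_Bset; lia.
have := tB b.1.2; have := tB (nE k l - b.1.1)%N; rewrite !mem_Bset bb !leqnn.
move=> /(_ isT)/and3P[_ _ h1] /(_ isT)/and3P[_ h2 _]; split=> //.
move: h1 (ltn_ord b.1.1) (ltn_ord b'.1.1); rewrite /nE; lia.
Qed.

Lemma le_Mbound ij : (M ij.1 ij.2 <= Mbound M)%N.
Proof.
rewrite /Mbound (bigD1 ij.1) //= (bigD1 ij.2) //= -addnA; exact: leq_addr.
Qed.

Definition block_label ij (c : 'I_(M ij.1 ij.2)) : label :=
  (ij, widen_ord (le_Mbound ij) c).

Lemma block_label_inj ij : injective (@block_label ij).
Proof. by move=> c c' [/val_inj]. Qed.

Lemma block_label_in ij (c : 'I_(M ij.1 ij.2)) t :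
  (ij.2 <= t <= nE k l - ij.1)%N -> block_label c \in Bset M t.
Proof. by rewrite mem_Bset /= ltn_ord. Qed.

Lemma block_labelP b t : b \in Bset M t -> exists c, b = @block_label b.1 c.
Proof.
case: b => ij c; rewrite mem_Bset /= => /and3P[cM _ _].
by exists (Ordinal cM); congr pair; apply: val_inj.
Qed.

Lemma block_label_center ij (c : 'I_(M ij.1 ij.2)) : block_label c \in Bset M l.-1.
Proof.
apply: block_label_in; rewrite /nE.
by have := ltn_ord ij.1; have := ltn_ord ij.2; lia.
Qed.

Lemma block_labels t ij : (ij.2 <= t <= nE k l - ij.1)%N ->
  [set b in Bset M t | b.1 == ij] = (@block_label ij) @: setT.
Proof.
move=> ijt; apply/setP => b; rewrite in_set.
apply/andP/imsetP => [[bt /eqP bij]|[c _ ->]]; last by rewrite block_label_in.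
by have [c bE] := block_labelP bt; subst ij; exists c.
Qed.

Lemma sum_block t ij (f : label -> F) : (ij.2 <= t <= nE k l - ij.1)%N ->
  (forall b, b \in Bset M t -> b.1 != ij -> f b = 0) ->
  \sum_(b in Bset M t) f b = \sum_(c < M ij.1 ij.2) f (block_label c).
Proof.
move=> ijt f0; rewrite (bigID (fun b => b.1 == ij)) /= [X in _ + X]big1 ?addr0; last first.
  by move=> b /andP[/f0].
transitivity (\sum_(b in (@block_label ij) @: setT) f b); last first.
  rewrite big_imset /=; first by apply: eq_bigl => c; rewrite in_setT.
  by move=> c c' _ _; apply: block_label_inj.
by rewrite -(block_labels ijt); apply: eq_bigl => b; rewrite [RHS]in_set.
Qed.

Definition diag_blocks g : blocks :=
  [ffun ij => \matrix_(c, c') ent (g center) (block_label c) (block_label c')].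

(** Triangularity of [g] and of [h] bounds an intermediate label from both sides, so it stays in
    block [ij]. *)
Lemma diag_blocksM g h ij : g \in std_end F M -> h \in std_end F M ->
  diag_blocks (vm_mul g h) ij = diag_blocks g ij *m diag_blocks h ij.
Proof.
move=> gE hE; apply/matrixP => c c'; rewrite !ffunE !mxE ent_mul.
have ijl : (ij.2 <= l.-1 <= nE k l - ij.1)%N.
  by have := block_label_center c; rewrite mem_Bset /= => /andP[].
rewrite (sum_block ijl) => [|b bl bij].
  by apply: eq_bigr => c'' _; rewrite !mxE.
apply/eqP; apply: contraNT bij; rewrite mulf_eq0 negb_or => /andP[gb hb].
have [/= i1 j1] := ent_triangular gE gb; have [/= i2 j2] := ent_triangular hE hb.
case: b.1 ij {c c' ijl gb hb} i1 j1 i2 j2 => i j [i' j'] /= i1 j1 i2 j2.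
by apply/eqP; congr pair; apply: val_inj; apply/eqP; rewrite eqn_leq ?i1 ?i2 ?j1 ?j2.
Qed.

Lemma diag_blocks1 ij : diag_blocks (vm_one F M) ij = 1%:M.
Proof.
apply/matrixP => c c'; rewrite !ffunE !mxE ent1 ?block_label_center //.
by rewrite (inj_eq (@block_label_inj ij)).
Qed.

Lemma std_autP g : (g \in std_aut F M) = (g \in vm_unit F M) && (g \in std_end F M).
Proof. by rewrite std_autE in_set. Qed.

Lemma std_autV g : g \in std_aut F M -> vm_inv g \in std_aut F M.
Proof.
rewrite !mem_std_aut => /andP[gU gQ]; rewrite vm_unitV //=.
by rewrite -(Qpart_act _ gQ) actK // Qpart_std_rep.
Qed.

Lemma std_aut_diag_unit g ij : g \in std_aut F M -> diag_blocks g ij \in unitmx.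
Proof.
move=> gA; have := std_autV gA; move: (gA); rewrite !std_autP.
move=> /andP[gU gE] /andP[_ g'E]; have := diag_blocksM ij gE g'E.
by rewrite vm_mulrV // diag_blocks1 => /esym/mulmx1_unit[].
Qed.

(* If a row vector v is killed by [g t], look at a label b with v_b != 0 and
   b.1.1 + b.1.2 maximal: by triangularity only the block of b contributes to the
   coordinates of v g in that block, so a diagonal block has a nonzero kernel. *)
Lemma diag_unit_std_aut g : g \in std_end F M ->
  (forall ij, diag_blocks g ij \in unitmx) -> g \in std_aut F M.
Proof.
move=> gE gD; rewrite std_autP gE andbT; apply/vm_unitP => t.
apply: unitmx_inj => v vg; apply/eqP; apply: contraT => /rV0Pn[x0 vx0].
pose w (x : 'I_(pdim M t)) := ((bval x).1.1 + (bval x).1.2)%N.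
have [x vx xmax] := arg_maxnP (P := fun x => v 0 x != 0) w vx0.
pose ij := (bval x).1.
have ijt : (ij.2 <= t <= nE k l - ij.1)%N.
  by have := bval_in x; rewrite mem_Bset => /andP[].
pose vb b : F := \sum_y (if bval y == b then v 0 y else 0).
have vbE y : vb (bval y) = v 0 y.
  rewrite /vb (bigD1 y) //= big1 ?addr0 ?eqxx // => y' ny.
  by rewrite (inj_eq (@bval_inj t)) (negPf ny).
pose u := \row_(c < M ij.1 ij.2) vb (block_label c).
have u0 : u = 0.
  apply: (can_inj (mulmxK (gD ij))); rewrite mul0mx; apply/rowP => c.
  have [y yE] := bvalP (block_label_in c ijt).
  have := congr1 (fun A : 'rV_(pdim M t) => A 0 y) vg; rewrite !mxE.
  under eq_bigr => z _ do rewrite -(ent_bval (g t)) yE -vbE.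
  rewrite -(sum_Bset t (fun b => vb b * ent (g t) b (block_label c))).
  rewrite (sum_block ijt) => [E|b bt bij].
    rewrite -[RHS]E; apply: eq_bigr => c' _.
    by rewrite /u mxE ffunE mxE (ent_center _ gE) ?block_label_in.
  apply/eqP; apply: contraNT bij; rewrite mulf_eq0 negb_or => /andP[vb0].
  rewrite (ent_center _ gE) // => /(ent_triangular gE)[/= i1 j1].
  have [z zb] := bvalP bt; rewrite -zb vbE in vb0.
  (* Maximality bounds the index sum of [b] from above, triangularity bounds each index from below;
     hence [b] lies in block [ij]. *)
  have := xmax z vb0; rewrite /w zb -/ij.
  case: b.1 i1 j1 => i j; case: (ij) => i' j' /= i1 j1 le.
  have ei : i = i' by apply: val_inj => /=; lia.
  have ej : j = j' by apply: val_inj => /=; lia.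
  by rewrite ei ej.
have [c xE] := block_labelP (bval_in x).
case/eqP: vx; rewrite -vbE xE.
by have := congr1 (fun A : 'rV_(M ij.1 ij.2) => A 0 c) u0; rewrite !mxE.
Qed.

(** Labels carry an index below [Mbound M], not below the block size, hence natural indices and the
    default 0. *)
Definition blk_ent m (A : 'M[F]_m) (c c' : nat) : F :=
  match (insub c : option 'I_m), (insub c' : option 'I_m) with
  | Some x, Some y => A x y
  | _, _ => 0
  end.

Definition of_blocks d : VertMaps :=
  [ffun t => \matrix_(x, y)
    (if (bval x).1 == (bval y).1
     then blk_ent (d (bval x).1) (bval x).2 (bval y).2 else 0)].

Lemma ent_of_blocks d t b b' : b \in Bset M (nat_of_ord t) -> b' \in Bset M t ->
  ent (of_blocks d t) b b'
    = if b.1 == b'.1 then blk_ent (d b.1) b.2 b'.2 else 0.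
Proof. by move=> /bvalP[x <-] /bvalP[y <-]; rewrite ent_bval ffunE mxE. Qed.

(** Labels of one block occur at the same vertices. If a label is missing where its partner is
    present, the two lie in different blocks and the entry is 0. *)
Lemma of_blocks_end d : of_blocks d \in std_end F M.
Proof.
have out t t' b b' : b \in Bset M t -> b' \in Bset M t' -> b' \notin Bset M t ->
    b.1 != b'.1.
  rewrite !mem_Bset => /and3P[_ bt1 bt2] /and3P[-> _ _]; apply: contra => /eqP <-.
  by rewrite bt1.
apply/QendP => e b b'; have bF := @Bset_fwd e b; have bB := @Bset_bwd e b.
case: (boolP (fwd l e)) bF bB => [_ /(_ isT) bS _|_ _ /(_ isT) bS] be b'e.
  rewrite ent_of_blocks ?bS //.
  have [b'e'|b'e'] := boolP (b' \in Bset M e); first by rewrite ent_of_blocks.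
  by rewrite (negPf (out _ _ _ _ be b'e b'e')) ent_eq0_out.
rewrite ent_of_blocks ?bS //.
have [b'e'|b'e'] := boolP (b' \in Bset M e.+1); first by rewrite ent_of_blocks.
by rewrite (negPf (out _ _ _ _ be b'e b'e')) ent_eq0_out.
Qed.

Lemma of_blocksK d : diag_blocks (of_blocks d) = d.
Proof.
apply/ffunP => ij; apply/matrixP => c c'; rewrite ffunE mxE.
by rewrite ent_of_blocks ?block_label_center //= eqxx /blk_ent !valK.
Qed.

Lemma std_end_axpy a g h : g \in std_end F M -> h \in std_end F M ->
  vm_axpy a g h \in std_end F M.
Proof.
move=> /std_endP g0 /std_endP h0; apply/std_endP => V VQ.
by rewrite relation_pairing_axpy g0 // h0 // mulr0 addr0.
Qed.

Lemma diag_blocks_axpy1 g h ij :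
  diag_blocks (vm_axpy 1 g h) ij = diag_blocks h ij + diag_blocks g ij.
Proof. by apply/matrixP => c c'; rewrite !ffunE !mxE scale1r entD. Qed.

Lemma diag_blocks_axpyN1 g h ij :
  diag_blocks (vm_axpy (-1) g h) ij = diag_blocks h ij - diag_blocks g ij.
Proof.
apply: (canRL (addrK _)); rewrite -diag_blocks_axpy1.
by rewrite -{1}[1]opprK vm_axpyK.
Qed.

(** [diag_blocks] is additive, so translating by the block diagonal lift of [d] identifies the two
    fibers. *)
Lemma card_diag_fiber d :
  #|[set g in std_end F M | diag_blocks g == d]|
    = #|[set g in std_end F M | diag_blocks g == [ffun=> 0]]|.
Proof.
apply: (card_bij_in (f := vm_axpy (-1) (of_blocks d)) (g := vm_axpy 1 (of_blocks d))).
- move=> g; rewrite in_set => /andP[gE /eqP gd].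
  rewrite in_set std_end_axpy ?of_blocks_end //=; apply/eqP/ffunP => ij.
  by rewrite diag_blocks_axpyN1 of_blocksK gd ffunE subrr.
- move=> g; rewrite in_set => /andP[gE /eqP gd].
  rewrite in_set std_end_axpy ?of_blocks_end //=; apply/eqP/ffunP => ij.
  by rewrite diag_blocks_axpy1 of_blocksK gd ffunE add0r.
- by move=> g _; rewrite -{1}[1]opprK vm_axpyK.
- by move=> g _; rewrite vm_axpyK.
Qed.

(** [diag_blocks] maps End onto all block families and Aut onto the invertible ones, with fibers of
    the same size [K]: an endomorphism over an invertible family is already an automorphism. *)
Lemma card_end_aut :
  (#|std_end F M| * #|[set d : blocks | [forall ij, d ij \in unitmx]]|
     = #|std_aut F M| * #|{: blocks}|)%N.
Proof.
pose K := #|[set g in std_end F M | diag_blocks g == [ffun=> 0]]|.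
have -> : (#|std_end F M| = #|{: blocks}| * K)%N.
  rewrite -cardsT; apply: (card_fibers (f := diag_blocks)) => [g _|d _].
    by rewrite in_setT.
  exact: card_diag_fiber.
have -> : (#|std_aut F M| = #|[set d : blocks | [forall ij, d ij \in unitmx]]| * K)%N.
  apply: (card_fibers (f := diag_blocks)) => [g gA|d].
    by rewrite inE; apply/forallP => ij; apply: std_aut_diag_unit.
  rewrite inE => /forallP dU; rewrite -[RHS](card_diag_fiber d).
  apply: eq_card => g; rewrite [LHS]in_set [RHS]in_set.
  apply/andP/andP => [] [gA /eqP gd]; rewrite gd; split=> //.
    by have := gA; rewrite std_autP => /andP[].
  by apply: diag_unit_std_aut => // ij; rewrite gd.
by rewrite -mulnA mulnC; congr (_ * _)%N; rewrite mulnC.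
Qed.

End Blocks.

(** * The Euler form *)

Definition ext (m : nat) (a : 'I_m -> nat) (s : nat) : nat :=
  if insub s is Some j then a j else 0%N.

Lemma ext_ord m (a : 'I_m -> nat) (j : 'I_m) : ext a j = a j.
Proof. by rewrite /ext valK. Qed.

Lemma psum_ext m (a : 'I_m -> nat) t : (t <= m)%N ->
  psum (ext a) t = (\sum_(j < m | (j < t)%N) a j)%N.
Proof.
move=> tm; rewrite /psum (big_ord_widen m (ext a) tm).
by apply: eq_bigr => j _; rewrite ext_ord.
Qed.

(** Cuts the quiver into its two branches, each indexed from its outer end. *)
Lemma sum_split_rev (a b : nat) (f : nat -> nat) :
  (\sum_(t < a + b) f t = \sum_(t < a) f t + \sum_(s < b) f (a + b - s.+1))%N.
Proof.
rewrite big_split_ord /=; congr (_ + _)%N.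
rewrite (reindex_inj rev_ord_inj) /=; apply: eq_bigr => s _.
by rewrite addnBA.
Qed.

Lemma nfun_ext m (a : 'I_m -> nat) : (\sum_(t < m) 'C(ext a t, 2) = nfun a)%N.
Proof. by apply: eq_bigr => j _; rewrite ext_ord. Qed.

Section EulerForm.
Variables (k l : nat) (M : 'M[nat]_(k, l)) (alpha : 'I_k -> nat) (beta : 'I_l -> nat).
Hypotheses (k_gt0 : (0 < k)%N) (l_gt0 : (0 < l)%N).
Hypothesis rowM : forall i, (\sum_(j < l) M i j)%N = alpha i.
Hypothesis colM : forall j, (\sum_(i < k) M i j)%N = beta j.

Lemma pdimE t : pdim M t =
  (\sum_(i < k) \sum_(j < l | (j <= t)%N && (t <= nE k l - i)%N) M i j)%N.
Proof.
rewrite pair_big_dep /= /pdim -sum1_card.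
rewrite (partition_big fst (fun ij : 'I_k * 'I_l => (ij.2 <= t <= nE k l - ij.1)%N)) /=; last first.
  by move=> b; rewrite mem_Bset => /and3P[_ -> ->].
apply: eq_bigr => -[i j] ijt.
have := congr1 (fun A : {set _} => #|A|) (block_labels M ijt).
rewrite card_imset; last exact: block_label_inj.
rewrite cardsT card_ord /= => <-; rewrite -sum1_card.
by apply: eq_bigl => b; rewrite [RHS]in_set.
Qed.

(** Left of the center the upper bound on the support holds for every row, so whole columns are
    summed; on the right the roles are exchanged. *)
Lemma pdim_left t : (t <= l.-1)%N -> pdim M t = psum (ext beta) t.+1.
Proof.
move=> tl; rewrite pdimE psum_ext; last by lia.
under eq_bigr => i _.
  rewrite (eq_bigl (fun j : 'I_l => (j <= t)%N)); last first.
    by move=> j; have := ltn_ord i; rewrite /nE; lia.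
  over.
by rewrite exchange_big /=; apply: eq_bigr => j _; rewrite colM.
Qed.

Lemma pdim_right s : (s <= k.-1)%N -> pdim M (nE k l - s) = psum (ext alpha) s.+1.
Proof.
move=> sk; rewrite pdimE psum_ext; last by lia.
rewrite [RHS]big_mkcond; apply: eq_bigr => i _.
rewrite ltnS; case: (leqP i s) => si.
  rewrite -rowM; apply: eq_bigl => j; have := ltn_ord i; have := ltn_ord j.
  by rewrite /nE; lia.
rewrite big1 // => j; have := ltn_ord i; rewrite /nE; lia.
Qed.

Lemma euler_form n : (\sum_(j < l) beta j)%N = n -> (\sum_(i < k) alpha i)%N = n ->
  (\sum_(t < (nE k l).+1) pdim M t ^ 2
     = \sum_(e < nE k l) pdim M e * pdim M e.+1 + (n + nfun alpha + nfun beta))%N.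
Proof.
move=> bn an; have nEE : nE k l = (l.-1 + k.-1)%N by rewrite /nE; lia.
have Bn : psum (ext beta) l = n.
  by rewrite psum_ext // -bn; apply: eq_bigl => j; rewrite ltn_ord.
have An : psum (ext alpha) k = n.
  by rewrite psum_ext // -an; apply: eq_bigl => j; rewrite ltn_ord.
have := psum_quadratic (ext beta) l.-1; have := psum_quadratic (ext alpha) k.-1.
rewrite (prednK k_gt0) (prednK l_gt0) An Bn !nfun_ext => QA QB.
(* The center is counted with the left branch only. *)
have -> : (\sum_(t < (nE k l).+1) pdim M t ^ 2
   = \sum_(t < l) psum (ext beta) t.+1 ^ 2 + \sum_(s < k.-1) psum (ext alpha) s.+1 ^ 2)%N.
  rewrite nEE -addSn (prednK l_gt0) (sum_split_rev l k.-1 (fun t => pdim M t ^ 2)%N).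
  congr (_ + _)%N; apply: eq_bigr => t _; have := ltn_ord t => tlt.
    by rewrite pdim_left //; lia.
  have -> : (l + k.-1 - t.+1 = nE k l - t)%N by rewrite /nE; lia.
  by rewrite pdim_right //; lia.
have -> : (\sum_(e < nE k l) pdim M e * pdim M e.+1
   = \sum_(t < l.-1) psum (ext beta) t.+1 * psum (ext beta) t.+2
     + \sum_(s < k.-1) psum (ext alpha) s.+1 * psum (ext alpha) s.+2)%N.
  rewrite nEE (sum_split_rev l.-1 k.-1 (fun e => pdim M e * pdim M e.+1)%N).
  congr (_ + _)%N; apply: eq_bigr => t _; have := ltn_ord t => tlt.
    by rewrite !pdim_left //; lia.
  have -> : ((l.-1 + k.-1 - t.+1).+1 = nE k l - t)%N by rewrite /nE; lia.
  have -> : (l.-1 + k.-1 - t.+1 = nE k l - t.+1)%N by rewrite /nE; lia.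
  by rewrite mulnC !pdim_right //; lia.
have SA : (\sum_(s < k) psum (ext alpha) s.+1 ^ 2
    = \sum_(s < k.-1) psum (ext alpha) s.+1 ^ 2 + n ^ 2)%N.
  have recr m (f : nat -> nat) : (0 < m)%N ->
      (\sum_(s < m) f s = \sum_(s < m.-1) f s + f m.-1)%N.
    by case: m => // m _; rewrite big_ord_recr.
  by rewrite (recr k (fun s => psum (ext alpha) s.+1 ^ 2)%N) // prednK // An.
(* The two branch identities count the center twice; removing n^2 = n + 2 C(n,2) from their 2n + 2
   C(n,2) leaves n. *)
move: SA QA QB (square_bin2 n); do ![move: (\sum_(i < _) _)%N => ?]; lia.
Qed.

End EulerForm.

(** * Assembling the counts *)

Lemma card_block_units (F : finFieldType) (k l : nat) (M : 'M[nat]_(k, l))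
    (q := (#|F|%:R)^-1 : rat) :
  #|[set d : {dffun forall ij : 'I_k * 'I_l, 'M[F]_(M ij.1 ij.2)} |
      [forall ij, d ij \in unitmx]]|%:R
  = #|{: {dffun forall ij : 'I_k * 'I_l, 'M[F]_(M ij.1 ij.2)}}|%:R
    * \prod_(i < k) \prod_(j < l) ((1 - q) ^+ M i j * qfact q (M i j)).
Proof.
rewrite card_dep_ffun foldrE big_image /=.
rewrite (@card_dep_family _ (fun ij : 'I_k * 'I_l => 'M[F]_(M ij.1 ij.2) : finType)
  (fun ij => [pred A | A \in unitmx])).
rewrite !natr_prod pair_big /= -big_split /=; apply: eq_bigr => ij _.
by rewrite card_unitmx mulrA.
Qed.

Theorem theorem8p33 (F : finFieldType) (k l n : nat)
  (alpha : 'I_k -> nat) (beta : 'I_l -> nat) (M : 'M[nat]_(k, l)) :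
  (0 < k)%N -> (0 < l)%N ->
  (\sum_(i < k) alpha i)%N = n -> (\sum_(j < l) beta j)%N = n ->
  (forall i : 'I_k, (\sum_(j < l) M i j)%N = alpha i) ->
  (forall j : 'I_l, (\sum_(i < k) M i j)%N = beta j) ->
  let q : rat := (#|F|%:R)^-1 in
  sum_inv_aut F M =
    q ^+ (n + nfun alpha + nfun beta) * ((1 - q) ^+ n)^-1
    / \prod_(i < k) \prod_(j < l) qfact q (M i j).
Proof.
move=> k0 l0 an bn rowM colM q.
have p0 : (#|F|%:R : rat) != 0.
  by rewrite pnatr_eq0 -lt0n ltnW // card_finNzRing_gt1.
have DUE := card_block_units F M; move: DUE; rewrite /= -/q.
(* The exponents of 1 - q add up along the rows to [alpha i], and then to [n]. *)
under eq_bigr => i _ do rewrite big_split prodrXr rowM.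
rewrite big_split prodrXr an /=; set Q := \prod_(i < k) _ => DUE.
have DU0 : #|[set d : {dffun forall ij : 'I_k * 'I_l, 'M[F]_(M ij.1 ij.2)} |
    [forall ij, d ij \in unitmx]]|%:R != 0 :> rat.
  rewrite pnatr_eq0 -lt0n; apply/card_gt0P; exists [ffun=> 1%:M].
  by rewrite inE; apply/forallP => ij; rewrite ffunE unitmx1.
have A0 : #|std_aut F M|%:R != 0 :> rat.
  rewrite pnatr_eq0 -lt0n; apply/card_gt0P; exists (vm_one F M).
  by rewrite mem_std_aut vm_unit1 act1 Qpart_std_rep.
have := congr1 (fun m => m%:R : rat) (card_end_aut F M k0 l0).
have := congr1 (fun m => m%:R : rat) (card_std_end F M).
rewrite card_VertMaps card_Qpart_std_set (euler_form k0 l0 rowM colM bn an).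
rewrite expnD !natrM !natrX DUE => YE EE.
rewrite {}DUE in DU0; rewrite sum_inv_aut_std.
move: DU0; rewrite !mulf_eq0 !negb_or => /andP[D0 /andP[n0 Q0]].
have P0 := expf_neq0 (\sum_(e < nE k l) pdim M e * pdim M e.+1)%N p0.
have N0 := expf_neq0 (n + nfun alpha + nfun beta)%N p0.
(* The power of q becomes an inverse power of |F|. Denominators are then cleared so that [YE]
   eliminates the number of structures and [EE] closes the identity. *)
rewrite /q exprVn -/q; apply: (mulIf A0); rewrite divfK //.
apply: (mulIf N0); apply: (mulIf P0); rewrite -mulrA [X in _ * X]mulrC -YE.
apply: (mulIf D0); apply: (mulIf n0); apply: (mulIf Q0).
move: EE D0 A0 n0 Q0 N0 {YE P0}.
move: (#|std_end F M|%:R : rat) (#|std_aut F M|%:R : rat)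
  (#|{: {dffun forall ij : 'I_k * 'I_l, 'M[F]_(M ij.1 ij.2)}}|%:R : rat)
  (_ ^+ (n + nfun alpha + nfun beta)) (_ ^+ \sum_(e < _) _) ((1 - q) ^+ n) Q.
move=> x a d N P y Q' EE _ _ y0 Q0 N0.
have -> : x * P * d * y * Q' = a * d * P by rewrite -EE; ring.
by field; rewrite y0 Q0 N0.
Qed.
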